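(* Let $A\in\mathbb{R}^{n\times n}$ be symmetric, $B\in\mathbb{R}^{n\times n}$ symmetric positive semi-definite, $\alpha>0$, and $c,f\in\mathbb{R}^n$. If $(\bar\varsigma,\bar\sigma)=(\bar\varsigma,\bar\sigma_1,\bar\sigma_2)\in S_\sharp$ is a KKT point of $\Pi^d(\varsigma,\sigma)$, then the vector $(\bar x,\bar v)$ defined by $$\bar x=G^+(\bar\varsigma,\bar\sigma_1)c,\qquad \bar v=\tfrac12(f+\bar\sigma_1+\bar\sigma_2)\oslash\bar\sigma_2$$ is feasible for the primal problem $(\mathcal{P}_b)$, i.e. $(\bar x,\bar v)\in\chi_v$, and $$P(\bar x,\bar v)=\Xi(\bar x,\bar v,\bar\varsigma,\bar\sigma)=\Pi^d(\bar\varsigma,\bar\sigma).$$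
   Context: Primal problem $(\mathcal{P}_b)$: minimize $P(x,v)=\frac12x^TAx-c^Tx+\frac12\left(\frac12x^TBx-\alpha\right)^2-f^Tv$ over $\chi_v=\{(x,v)\in\mathbb{R}^n\times\{0,1\}^n : -v\le x\le v\}$ (inequalities between vectors are componentwise). Notation: $x\circ y$ is the componentwise (Hadamard) product, $t\oslash s$ is the componentwise quotient $(t_i/s_i)_i$, $\mathrm{Diag}(s)$ is the diagonal matrix with diagonal $s$, $G^+$ is the Moore-Penrose inverse of $G$, and $\mathcal{C}_{ol}(G)$ is the column space of $G$. For $\varsigma\in\mathbb{R}$ and $\sigma=(\sigma_1,\sigma_2)\in\mathbb{R}^n\times\mathbb{R}^n$ put $G(\varsigma,\sigma_1)=A+\varsigma B+2\,\mathrm{Diag}(\sigma_1)$. Dual feasible space: $S_\sharp=\{(\varsigma,\sigma)\in\mathbb{R}\times\mathbb{R}^{2n} : \varsigma\ge-\alpha,\ \sigma_1\ge0,\ \sigma_2>0,\ c\in\mathcal{C}_{ol}(G(\varsigma,\sigma_1))\}$. Total complementary function (for $\sigma_1,\sigma_2\ge 0$): $$\Xi(x,v,\varsigma,\sigma)=\tfrac12x^TG(\varsigma,\sigma_1)x-c^Tx+v^T\mathrm{Diag}(\sigma_2)v-(f+\sigma_1+\sigma_2)^Tv-\tfrac12\varsigma^2-\alpha\varsigma.$$ Canonical dual function on $S_\sharp$: $$\Pi^d(\varsigma,\sigma)=-\tfrac12c^TG^+(\varsigma,\sigma_1)c-\tfrac14\sum_{i=1}^n\frac{\left(f_i+(\sigma_1)_i+(\sigma_2)_i\right)^2}{(\sigma_2)_i}-\tfrac12\varsigma^2-\alpha\varsigma.$$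 KKT point: $(\bar\varsigma,\bar\sigma)\in S_\sharp$ is a KKT point of $\Pi^d$ (for the problem of maximizing $\Pi^d$ over $S_\sharp$) if there are multipliers $(\epsilon_0,\epsilon_1,\epsilon_2)\in\mathbb{R}\times\mathbb{R}^n\times\mathbb{R}^n$ for the three inequality constraints with $\epsilon_0=\nabla_\varsigma\Pi^d(\bar\varsigma,\bar\sigma)$, $\epsilon_1=\nabla_{\sigma_1}\Pi^d(\bar\varsigma,\bar\sigma)$, $\epsilon_2=\nabla_{\sigma_2}\Pi^d(\bar\varsigma,\bar\sigma)$, and $\epsilon_0\le0$, $\epsilon_1\le0$, $\epsilon_2\le0$, $\epsilon_0(\bar\varsigma+\alpha)=0$, $\bar\sigma_1^T\epsilon_1=0$, $\bar\sigma_2^T\epsilon_2=0$. Here the gradient is given, with $\bar x=G^+(\bar\varsigma,\bar\sigma_1)c$ and $\bar v=\frac12(f+\bar\sigma_1+\bar\sigma_2)\oslash\bar\sigma_2$, by $\nabla_\varsigma\Pi^d=\frac12\bar x^TB\bar x-\bar\varsigma-\alpha$, $\nabla_{\sigma_1}\Pi^d=\bar x\circ\bar x-\bar v$, $\nabla_{\sigma_2}\Pi^d=\bar v\circ\bar v-\bar v$ (these formulas are taken as the definition of the gradient also when $G(\bar\varsigma,\bar\sigma_1)$ is singular). *)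

(* Defs.v *)
From mathcomp Require Import all_boot all_order all_algebra.
From mathcomp Require Import reals.

Set Implicit Arguments.
Unset Strict Implicit.
Unset Printing Implicit Defensive.

Import Order.TTheory GRing.Theory Num.Theory.
Local Open Scope ring_scope.

(* The four Penrose equations; they determine X uniquely (penrose_uniq). The
   library's [pinvmx] is only a one-sided partial inverse and does not satisfy
   them in general. *)
Definition penrose (R : realFieldType) (m n : nat)
    (G : 'M[R]_(m, n)) (X : 'M[R]_(n, m)) : bool :=
  [&& G *m X *m G == G, X *m G *m X == X,
      (G *m X)^T == G *m X & (X *m G)^T == X *m G].

Lemma mulmx_trmx_eq0 (R : realFieldType) (n : nat) (w : 'rV[R]_n) :
  w *m w^T = 0 -> w = 0.
Proof.
move=> /matrixP/(_ 0 0); rewrite !mxE => /eqP.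
rewrite psumr_eq0 => [/allP h|i _]; last by rewrite mxE -expr2 sqr_ge0.
apply/rowP => i; rewrite mxE.
by have := h i (mem_index_enum i); rewrite mxE mulf_eq0 orbb => /eqP.
Qed.

Lemma gram_unitmx (R : realFieldType) (r n : nat) (M : 'M[R]_(r, n)) :
  row_free M -> M *m M^T \in unitmx.
Proof.
move=> Mfree; rewrite -row_free_unit -kermx_eq0; apply/eqP/row_matrixP => i.
rewrite row0; apply: (row_free_inj Mfree); rewrite mul0mx.
apply: mulmx_trmx_eq0; rewrite trmx_mul !mulmxA -(mulmxA _ M).
have /sub_kermxP -> : (row i (kermx (M *m M^T)) <= kermx (M *m M^T))%MS.
  exact: row_sub.
by rewrite mul0mx.
Qed.

Lemma penrose_exists (R : realFieldType) (m n : nat) (G : 'M[R]_(m, n)) :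
  exists X, penrose G X.
Proof.
have [r [C [W [GE Wfree Cfree]]]] : exists r (C : 'M[R]_(m, r))
    (W : 'M[R]_(r, n)), [/\ G = C *m W, row_free W & row_free C^T].
  exists (\rank G), (col_base G), (row_base G).
  split; [by rewrite mulmx_base|exact: row_base_free|].
  by rewrite /row_free mxrank_tr; exact: col_base_full.
have uW := gram_unitmx Wfree; have := gram_unitmx Cfree; rewrite trmxK => uC.
set WI := invmx (W *m W^T); set CI := invmx (C^T *m C).
have WIt : WI^T = WI by rewrite /WI trmx_inv trmx_mul trmxK.
have CIt : CI^T = CI by rewrite /CI trmx_inv trmx_mul trmxK.
pose X := W^T *m WI *m CI *m C^T.
have GX : G *m X = C *m CI *m C^T.
  rewrite GE /X !mulmxA -(mulmxA C W) -(mulmxA C _ WI).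
  by rewrite mulmxV // mulmx1.
have XG : X *m G = W^T *m WI *m W.
  rewrite GE /X !mulmxA -(mulmxA _ C^T C) -(mulmxA _ CI _).
  by rewrite mulVmx // mulmx1.
exists X; apply/and4P; split; apply/eqP.
- by rewrite GX GE !mulmxA -(mulmxA _ C^T C) -(mulmxA _ CI _) mulVmx // mulmx1.
- rewrite XG /X !mulmxA -(mulmxA _ W W^T) -(mulmxA _ (W *m W^T) WI).
  by rewrite mulmxV // mulmx1.
- by rewrite GX !trmx_mul trmxK CIt mulmxA.
- by rewrite XG !trmx_mul trmxK WIt mulmxA.
Qed.

Lemma penrose_uniq (R : realFieldType) (m n : nat) (G : 'M[R]_(m, n))
    (X Y : 'M[R]_(n, m)) : penrose G X -> penrose G Y -> X = Y.
Proof.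
move=> /and4P[/eqP x1 /eqP x2 /eqP x3 /eqP x4].
move=> /and4P[/eqP y1 /eqP y2 /eqP y3 /eqP y4].
have e1 : G *m X = G *m Y.
  rewrite -x3 -{1}y1 -(mulmxA (G *m Y)) trmx_mul y3 x3.
  by rewrite mulmxA x1.
have e2 : X *m G = Y *m G.
  by rewrite -x4 -{1}y1 -mulmxA mulmxA trmx_mul y4 x4 -mulmxA (mulmxA G) x1.
by rewrite -x2 e2 -mulmxA e1 mulmxA y2.
Qed.

Definition mp_inv (R : realFieldType) (m n : nat) (G : 'M[R]_(m, n)) :
    'M[R]_(n, m) := xchoose (penrose_exists G).

Lemma mp_invP (R : realFieldType) (m n : nat) (G : 'M[R]_(m, n)) :
  penrose G (mp_inv G).
Proof. exact: xchooseP. Qed.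

Definition dot (R : realType) (n : nat) (x y : 'cV[R]_n) : R :=
  (x^T *m y) 0 0.

Definition qform (R : realType) (n : nat) (M : 'M[R]_n) (x : 'cV[R]_n) : R :=
  (x^T *m M *m x) 0 0.

Definition psd (R : realType) (n : nat) (M : 'M[R]_n) : Prop :=
  forall x : 'cV[R]_n, 0 <= qform M x.

Definition hadamard (R : realType) (n : nat) (x y : 'cV[R]_n) : 'cV[R]_n :=
  \col_i (x i 0 * y i 0).

Definition hquot (R : realType) (n : nat) (t s : 'cV[R]_n) : 'cV[R]_n :=
  \col_i (t i 0 / s i 0).

Definition Diag (R : realType) (n : nat) (s : 'cV[R]_n) : 'M[R]_n :=
  diag_mx s^T.

Definition in_colspace (R : realType) (n : nat) (G : 'M[R]_n) (c : 'cV[R]_n) :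
  Prop := exists y : 'cV[R]_n, c = G *m y.

Definition P (R : realType) (n : nat) (A B : 'M[R]_n) (alpha : R)
    (c f x v : 'cV[R]_n) : R :=
  2^-1 * qform A x - dot c x + 2^-1 * (2^-1 * qform B x - alpha) ^+ 2 - dot f v.

Definition chi_v (R : realType) (n : nat) (x v : 'cV[R]_n) : Prop :=
  (forall i, v i 0 = 0 \/ v i 0 = 1) /\
  (forall i, - v i 0 <= x i 0 /\ x i 0 <= v i 0).

Definition Gmx (R : realType) (n : nat) (A B : 'M[R]_n) (vs : R)
    (s1 : 'cV[R]_n) : 'M[R]_n :=
  A + vs *: B + 2 *: Diag s1.

Definition S_sharp (R : realType) (n : nat) (A B : 'M[R]_n) (alpha : R)
    (c : 'cV[R]_n) (vs : R) (s1 s2 : 'cV[R]_n) : Prop :=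
  [/\ - alpha <= vs, (forall i, 0 <= s1 i 0), (forall i, 0 < s2 i 0)
    & in_colspace (Gmx A B vs s1) c].

Definition Xi (R : realType) (n : nat) (A B : 'M[R]_n) (alpha : R)
    (c f x v : 'cV[R]_n) (vs : R) (s1 s2 : 'cV[R]_n) : R :=
  2^-1 * qform (Gmx A B vs s1) x - dot c x + qform (Diag s2) v
  - dot (f + s1 + s2) v - 2^-1 * vs ^+ 2 - alpha * vs.

Definition Pi_d (R : realType) (n : nat) (A B : 'M[R]_n) (alpha : R)
    (c f : 'cV[R]_n) (vs : R) (s1 s2 : 'cV[R]_n) : R :=
  - (2^-1 * qform (mp_inv (Gmx A B vs s1)) c)
  - 4^-1 * (\sum_(i < n) (f i 0 + s1 i 0 + s2 i 0) ^+ 2 / s2 i 0)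
  - 2^-1 * vs ^+ 2 - alpha * vs.

Definition xbar (R : realType) (n : nat) (A B : 'M[R]_n) (c : 'cV[R]_n)
    (vs : R) (s1 : 'cV[R]_n) : 'cV[R]_n :=
  mp_inv (Gmx A B vs s1) *m c.

Definition vbar (R : realType) (n : nat) (f s1 s2 : 'cV[R]_n) : 'cV[R]_n :=
  2^-1 *: hquot (f + s1 + s2) s2.

(* The three blocks of the gradient of [Pi_d] are given by these formulas by
   convention, also where [Gmx A B vs s1] is singular and [Pi_d] need not be
   differentiable. *)
Definition grad_vs (R : realType) (n : nat) (A B : 'M[R]_n) (alpha : R)
    (c : 'cV[R]_n) (vs : R) (s1 : 'cV[R]_n) : R :=
  2^-1 * qform B (xbar A B c vs s1) - vs - alpha.

Definition grad_s1 (R : realType) (n : nat) (A B : 'M[R]_n)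
    (c f : 'cV[R]_n) (vs : R) (s1 s2 : 'cV[R]_n) : 'cV[R]_n :=
  hadamard (xbar A B c vs s1) (xbar A B c vs s1) - vbar f s1 s2.

Definition grad_s2 (R : realType) (n : nat) (f s1 s2 : 'cV[R]_n) : 'cV[R]_n :=
  hadamard (vbar f s1 s2) (vbar f s1 s2) - vbar f s1 s2.

Definition KKT_point (R : realType) (n : nat) (A B : 'M[R]_n) (alpha : R)
    (c f : 'cV[R]_n) (vs : R) (s1 s2 : 'cV[R]_n) : Prop :=
  S_sharp A B alpha c vs s1 s2 /\
  exists (e0 : R) (e1 e2 : 'cV[R]_n),
    [/\ e0 = grad_vs A B alpha c vs s1,
        e1 = grad_s1 A B c f vs s1 s2
      & e2 = grad_s2 f s1 s2] /\
    [/\ e0 <= 0, (forall i, e1 i 0 <= 0) & (forall i, e2 i 0 <= 0)] /\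
    [/\ e0 * (vs + alpha) = 0, dot s1 e1 = 0 & dot s2 e2 = 0].

(* Main.v *)
(* At a KKT point the multipliers vanish where they matter. The gradient in
   [s2] is zero because [s2 > 0], so [v_i ^ 2 = v_i]; the gradient in [s1] is
   nonpositive, so [x_i ^ 2 <= v_i]; and the gradient in [vs] is zero: otherwise
   [vs = - alpha], where it equals [x^T B x / 2 >= 0]. Complementarity then
   removes the terms of [Xi] in [s1] and [s2], and [vs = x^T B x / 2 - alpha]
   turns the remaining terms into [P]. The second equality uses only
   [G x = c] and [2 s2 v = f + s1 + s2]. *)

Require Import Defs.
From mathcomp Require Import all_boot all_order all_algebra.
From mathcomp Require Import reals.
From mathcomp Require Import ring lra.

Import Order.TTheory GRing.Theory Num.Theory.
Local Open Scope ring_scope.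

Lemma dotE (R : realType) (n : nat) (x y : 'cV[R]_n) :
  dot x y = \sum_i x i 0 * y i 0.
Proof. by rewrite /dot mxE; apply: eq_bigr => i _; rewrite mxE. Qed.

Lemma qform_dot (R : realType) (n : nat) (M : 'M[R]_n) (x : 'cV[R]_n) :
  qform M x = dot x (M *m x).
Proof. by rewrite /qform /dot mulmxA. Qed.

Lemma dotC (R : realType) (n : nat) (x y : 'cV[R]_n) : dot x y = dot y x.
Proof. by rewrite !dotE; apply: eq_bigr => i _; rewrite mulrC. Qed.

Lemma qform_Diag (R : realType) (n : nat) (s x : 'cV[R]_n) :
  qform (Diag s) x = \sum_i s i 0 * x i 0 ^+ 2.
Proof.
rewrite qform_dot dotE; apply: eq_bigr => i _.
by rewrite /Diag mul_diag_mx !mxE; ring.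
Qed.

Lemma qform_Gmx (R : realType) (n : nat) (A B : 'M[R]_n) (vs : R)
    (s1 x : 'cV[R]_n) :
  qform (Gmx A B vs s1) x =
  qform A x + vs * qform B x + 2 * qform (Diag s1) x.
Proof.
by rewrite /qform /Gmx !mulmxDr !mulmxDl -!scalemxAr -!scalemxAl !mxE.
Qed.

(** Writing [c] as [G *m y] reduces this to the first Penrose equation; it makes [xbar] a solution
    of [G x = c] even when [G] is singular. *)
Lemma mulmx_mp_inv (R : realType) (n : nat) (G : 'M[R]_n) (c : 'cV[R]_n) :
  in_colspace G c -> G *m (mp_inv G *m c) = c.
Proof.
by case=> y ->; have /and4P[/eqP GXG _ _ _] := mp_invP G; rewrite !mulmxA GXG.
Qed.

(** A vanishing sum of nonpositive terms has only zero terms. This splits the scalar complementarity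
    condition into coordinates. *)
Lemma dot_npos_eq0 (R : realType) (n : nat) (s e : 'cV[R]_n) :
  (forall i, 0 < s i 0) -> (forall i, e i 0 <= 0) -> dot s e = 0 ->
  forall i, e i 0 = 0.
Proof.
move=> s_gt0 e_le0; rewrite dotE => /eqP; rewrite -oppr_eq0 -sumrN.
rewrite psumr_eq0 => [/allP h i|i _]; last first.
  by rewrite oppr_ge0 mulr_ge0_le0 // ltW.
have := h i (mem_index_enum i).
by rewrite oppr_eq0 mulf_eq0 (gt_eqF (s_gt0 i)) => /eqP.
Qed.

Lemma KKT_vs (R : realType) (n : nat) (A B : 'M[R]_n) (alpha : R)
    (c f : 'cV[R]_n) (vs : R) (s1 s2 : 'cV[R]_n) :
  psd B -> KKT_point A B alpha c f vs s1 s2 ->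
  vs = 2^-1 * qform B (xbar A B c vs s1) - alpha.
Proof.
move=> B_psd [_ [e0 [_ [_ [[e0E _ _] [[e0_le0 _ _] [/eqP + _ _]]]]]]].
have := B_psd (xbar A B c vs s1); move: e0E e0_le0; rewrite /grad_vs.
by rewrite mulf_eq0 => ? ? ? /orP[] /eqP ?; lra.
Qed.

Lemma KKT_chi_v (R : realType) (n : nat) (A B : 'M[R]_n) (alpha : R)
    (c f : 'cV[R]_n) (vs : R) (s1 s2 : 'cV[R]_n) :
  KKT_point A B alpha c f vs s1 s2 ->
  chi_v (xbar A B c vs s1) (vbar f s1 s2).
Proof.
move=> [[_ _ s2_gt0 _] [e0 [e1 [e2 [[_ e1E e2E]]]]]].
move=> [[_ e1_le0 e2_le0] [_ _ /(dot_npos_eq0 _ _ _ _ s2_gt0 e2_le0) e2_eq0]].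
have v01 i : vbar f s1 s2 i 0 = 0 \/ vbar f s1 s2 i 0 = 1.
  have := e2_eq0 i; rewrite e2E /grad_s2; move: (vbar _ _ _) => v.
  rewrite !mxE => ve; have /eqP : v i 0 * (v i 0 - 1) = 0 by lra.
  by rewrite mulf_eq0 subr_eq0 => /orP[] /eqP; [left|right].
split=> // i; have := e1_le0 i; have := v01 i.
rewrite e1E /grad_s1; move: (vbar _ _ _) (xbar _ _ _ _ _) => v x.
(* The bound [x_i ^ 2 <= v_i] forces [x_i = 0] when [v_i = 0], and [-1 <= x_i <= 1] when
   [v_i = 1]. *)
by rewrite !mxE => -[] -> ?; split; nra.
Qed.

Lemma KKT_P_Xi (R : realType) (n : nat) (A B : 'M[R]_n) (alpha : R)
    (c f : 'cV[R]_n) (vs : R) (s1 s2 : 'cV[R]_n) :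
  psd B -> KKT_point A B alpha c f vs s1 s2 ->
  P A B alpha c f (xbar A B c vs s1) (vbar f s1 s2) =
  Xi A B alpha c f (xbar A B c vs s1) (vbar f s1 s2) vs s1 s2.
Proof.
move=> B_psd kkt; have vsE := KKT_vs _ _ _ _ _ _ _ _ _ _ B_psd kkt.
case: kkt => _ [e0 [e1 [e2 [[_ -> ->] [_ [_ s1e1 s2e2]]]]]].
move: vsE s1e1 s2e2; rewrite /grad_s1 /grad_s2.
move: (vbar _ _ _) (xbar _ _ _ _ _) => v x vsE s1e1 s2e2.
have {}s1e1 : qform (Diag s1) x = dot s1 v.
  apply/eqP; rewrite -subr_eq0 -s1e1 qform_Diag !dotE -sumrB.
  by apply/eqP/eq_bigr => i _; rewrite !mxE; ring.
have {}s2e2 : qform (Diag s2) v = dot s2 v.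
  apply/eqP; rewrite -subr_eq0 -s2e2 qform_Diag !dotE -sumrB.
  by apply/eqP/eq_bigr => i _; rewrite !mxE; ring.
have dotD : dot (f + s1 + s2) v = dot f v + dot s1 v + dot s2 v.
  by rewrite /dot !linearD /= !mulmxDl !mxE.
(* With [q = x^T B x / 2] and [vs = q - alpha], the terms in [vs] sum to [vs * q - vs ^ 2 / 2 -
   alpha * vs = (q - alpha) ^ 2 / 2]. *)
by rewrite /P /Xi qform_Gmx dotD s1e1 s2e2 vsE; field.
Qed.

(** The pair [xbar], [vbar] is a critical point of [Xi] in [(x, v)], and there a quadratic function
    equals half its linear part plus its constant. *)
Lemma Xi_Pi_d (R : realType) (n : nat) (A B : 'M[R]_n) (alpha : R)
    (c f : 'cV[R]_n) (vs : R) (s1 s2 : 'cV[R]_n) :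
  S_sharp A B alpha c vs s1 s2 ->
  Xi A B alpha c f (xbar A B c vs s1) (vbar f s1 s2) vs s1 s2 =
  Pi_d A B alpha c f vs s1 s2.
Proof.
move=> [_ _ s2_gt0 c_col]; rewrite /Xi /Pi_d.
have xGx : qform (Gmx A B vs s1) (xbar A B c vs s1) =
           dot c (xbar A B c vs s1).
  by rewrite qform_dot /xbar mulmx_mp_inv // dotC.
have cGc : qform (mp_inv (Gmx A B vs s1)) c = dot c (xbar A B c vs s1).
  exact: qform_dot.
(* Coordinatewise, [v = t / (2 s)] gives [s v ^ 2 - t v = - t ^ 2 / (4 s)]. *)
have vE : qform (Diag s2) (vbar f s1 s2) - dot (f + s1 + s2) (vbar f s1 s2) =
          - (4^-1 * \sum_(i < n) (f i 0 + s1 i 0 + s2 i 0) ^+ 2 / s2 i 0).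
  rewrite qform_Diag dotE -sumrB mulr_sumr -sumrN; apply: eq_bigr => i _.
  by rewrite !mxE; field; rewrite gt_eqF.
by rewrite xGx cGc -(addrA _ (qform _ _)) vE; field.
Qed.

Theorem theorem1 (R : realType) (n : nat) (A B : 'M[R]_n) (alpha : R)
    (c f : 'cV[R]_n) (vs : R) (s1 s2 : 'cV[R]_n)
    (A_sym : A^T = A) (B_sym : B^T = B) (B_psd : psd B) (alpha_gt0 : 0 < alpha)
    (kkt : KKT_point A B alpha c f vs s1 s2) :
  let x := mp_inv (Gmx A B vs s1) *m c in
  let v := 2^-1 *: hquot (f + s1 + s2) s2 in
  chi_v x v /\
  P A B alpha c f x v = Xi A B alpha c f x v vs s1 s2 /\
  Xi A B alpha c f x v vs s1 s2 = Pi_d A B alpha c f vs s1 s2.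
Proof.
move=> x v; split; first exact: KKT_chi_v kkt.
by split; [exact: KKT_P_Xi kkt|exact: Xi_Pi_d kkt.1].
Qed.
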